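(* Consider Dirichlet boundary conditions on $\partial\Omega$ and let $h=\min\{\Delta x,\Delta y\}$. Let $\gamma=1$ for the iterative IMEX-E Euler method and $\gamma=\frac32$ for the iterative IMEX-E 2SBDF method. The iterations defining the iterative IMEX-E Euler method, and the iterations defining the iterative IMEX-E 2SBDF method, converge if $$\left(h^2>\frac{4\sqrt2\,D_\phi}{w}\quad\text{or}\quad\Delta t<\frac{\gamma h^2}{4\sqrt2\,D_\phi-wh^2}\right)\quad\text{and}\quad\Delta t<\frac{\gamma(1+\sqrt3)}{8D_c}h^2.$$
   Context: Let $\Omega=[0,L_x]\times[0,L_y]$, let $\Theta$ be a set contained in the interior of $\Omega$ (the union of the holes), and $\widehat\Omega=\Omega\setminus\Theta$. The grid has nodes $(x_i,y_j)=(i\Delta x,j\Delta y)$, $1\le i\le m_x$, $1\le j\le m_y$, with $\Delta x=L_x/(m_x+1)$, $\Delta y=L_y/(m_y+1)$, ordered lexicographically (the node $(x_i,y_j)$ has index $i+(j-1)m_x$); $\Theta$ contains at least one grid node. The discrete Dirichlet Laplacian is $\mathcal M=I_{m_y}\otimes\mathcal M_x+\mathcal M_y\otimes I_{m_x}$, where for $r\in\{x,y\}$ the $m_r\times m_r$ matrix $\mathcal M_r$ is $\frac{1}{\Delta r^2}$ times the tridiagonal matrix with $-2$ on the diagonal and $1$ on the sub- and superdiagonal. The matrix $\mathcal N_1$ has entries $(\mathcal N_1)_{p,q}=\mathcal M_{p,q}$ if node $p$ is in $\Theta$ and node $q$ is in $\widehat\Omega$, and $0$ otherwise. The constants $D_\phi,D_c,w,\Delta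 t$ are positive. For the IMEX-E methods put $\mathcal N=\mathcal N_1$. At each time step the iterative Euler method consists of the two iterations in $k=0,1,2,\dots$ $$((1+w\Delta t)I-\Delta tD_\phi\mathcal M)\boldsymbol\phi^{n+1,k+1}=-\Delta tD_\phi\mathcal N\boldsymbol\phi^{n+1,k}+\mathbf g_\phi,\qquad (I-\Delta tD_c\mathcal M)\mathbf c^{n+1,k+1}=-\Delta tD_c\mathcal N\mathbf c^{n+1,k}+\mathbf g_c,$$ and the iterative 2SBDF method of the two iterations $$((3+2w\Delta t)I-2\Delta tD_\phi\mathcal M)\boldsymbol\phi^{n+2,k+1}=-2\Delta tD_\phi\mathcal N\boldsymbol\phi^{n+2,k}+\mathbf g_\phi,\qquad (3I-2\Delta tD_c\mathcal M)\mathbf c^{n+2,k+1}=-2\Delta tD_c\mathcal N\mathbf c^{n+2,k}+\mathbf g_c,$$ where $\mathbf g_\phi,\mathbf g_c$ are known vectors built from already computed quantities and independent of $k$. Convergence means convergence of the sequences as $k\to\infty$ for every starting iterate. *)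

(* Defs.v *)
From mathcomp Require Import all_boot all_order all_algebra.
From mathcomp Require Import all_classical all_reals all_analysis.
From mathcomp Require Import mxtens.

Set Implicit Arguments.
Unset Strict Implicit.
Unset Printing Implicit Defensive.

Import Order.TTheory GRing.Theory Num.Theory.
Import numFieldNormedType.Exports.

Local Open Scope classical_set_scope.
Local Open Scope ring_scope.

Section Defs.
Context {R : realType}.

Definition Omega (Lx Ly : R) : set (R * R) :=
  [set` `[0, Lx]] `*` [set` `[0, Ly]].

Definition Omega_hat (Lx Ly : R) (Theta : set (R * R)) : set (R * R) :=
  Omega Lx Ly `\` Theta.

Definition mesh (L : R) (m : nat) : R := L / m.+1%:R.

(* [mxtens_unindex p] is the pair (j, i) of 0-based indices with
   p = j * mx + i, so this is the lexicographic ordering with x running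
   fastest, in agreement with the Kronecker product [*t] below. *)
Definition node (Lx Ly : R) (mx my : nat) (p : 'I_(my * mx)) : R * R :=
  let: (j, i) := mxtens_unindex p in
  (i.+1%:R * mesh Lx mx, j.+1%:R * mesh Ly my).

Definition lap1 (m : nat) (d : R) : 'M[R]_m :=
  (d ^+ 2)^-1 *: \matrix_(i < m, j < m)
    (if i == j then - 2%:R
     else if (i.+1 == j :> nat) || (j.+1 == i :> nat) then 1 else 0).

Definition lap (Lx Ly : R) (mx my : nat) : 'M[R]_(my * mx) :=
  (1%:M : 'M[R]_my) *t lap1 mx (mesh Lx mx) +
  lap1 my (mesh Ly my) *t (1%:M : 'M[R]_mx).

Definition lapN1 (Lx Ly : R) (mx my : nat) (Theta : set (R * R)) :
    'M[R]_(my * mx) :=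
  \matrix_(p, q)
    (if (node Lx Ly p \in Theta) && (node Lx Ly q \in Omega_hat Lx Ly Theta)
     then lap Lx Ly mx my p q else 0).

Definition iterates (n : nat) (A B : 'M[R]_n) (g x0 : 'cV[R]_n)
    (x : nat -> 'cV[R]_n) : Prop :=
  x 0%N = x0 /\ forall k, A *m x k.+1 = B *m x k + g.

(* The scheme is implicit: the first conjunct says that it can be run from
   every starting iterate, so that the second one is not vacuous when [A] is
   singular. *)
Definition iteration_converges (n : nat) (A B : 'M[R]_n) (g : 'cV[R]_n) :
    Prop :=
  forall x0 : 'cV[R]_n,
    (exists x, iterates A B g x0 x) /\
    (forall x, iterates A B g x0 x -> exists l : 'cV[R]_n, x @ \oo --> l).

(* The vectors g collect the data of previous time steps, which are not
   restricted: convergence is required for arbitrary g. *)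
Definition euler_converges (n : nat) (M N : 'M[R]_n) (Dphi Dc w dt : R) :
    Prop :=
  forall gphi gc : 'cV[R]_n,
    iteration_converges ((1 + w * dt)%:M - (dt * Dphi) *: M)
      (- (dt * Dphi) *: N) gphi /\
    iteration_converges (1%:M - (dt * Dc) *: M) (- (dt * Dc) *: N) gc.

Definition sbdf2_converges (n : nat) (M N : 'M[R]_n) (Dphi Dc w dt : R) :
    Prop :=
  forall gphi gc : 'cV[R]_n,
    iteration_converges ((3 + 2 * w * dt)%:M - (2 * dt * Dphi) *: M)
      (- (2 * dt * Dphi) *: N) gphi /\
    iteration_converges (3%:M - (2 * dt * Dc) *: M) (- (2 * dt * Dc) *: N) gc.

(* Where the denominator of the second disjunct is zero, the quotient is 0 by
   convention and that disjunct fails for dt > 0; where it is negative the first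
   disjunct holds (w > 0). *)
Definition step_condition (gamma h Dphi Dc w dt : R) : Prop :=
  (h ^+ 2 > 4 * Num.sqrt 2 * Dphi / w \/
   dt < gamma * h ^+ 2 / (4 * Num.sqrt 2 * Dphi - w * h ^+ 2)) /\
  dt < gamma * (1 + Num.sqrt 3) / (8 * Dc) * h ^+ 2.

End Defs.

(* Main.v *)
Require Import Defs.
From mathcomp Require Import all_boot all_order all_algebra.
From mathcomp Require Import all_classical all_reals all_analysis.
From mathcomp Require Import mxtens.
From mathcomp Require Import ring lra.

(** Both schemes have the form A x' = B x + g, where A = a I - tau M and, because
    a I is diagonal, B = - tau N consists of the entries of A with row in the
    set S of hole nodes and column outside S. The proof is a contraction
    argument in the sup norm and uses only the diagonal dominance of A.

    Suppose that the off-diagonal absolute row sums of A are at most theta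
    times the diagonal, with 0 <= theta < 1, and let A u = B v. Write p and q
    for the maxima of |u| on S and off S, and c for that of |v| off S. A row
    off S reads (A u)_i = 0, so q <= theta max(p, q), that is q <= theta p.
    A row in S reads sum_j A_ij (u_j - [j not in S] v_j) = 0, so
    p <= theta max(p, q + c), that is p <= theta (q + c). Eliminating p gives
    q <= theta^2 / (1 - theta^2) c. Off S the map v |-> u is therefore a strict
    contraction as soon as 2 theta^2 < 1, and the values on S are controlled
    by those off S at the previous step ([coupling_step]). Invertibility of A
    and of A - B, hence the existence of the iterates and of their limit,
    comes from the same estimate ([coupling_iteration_converges]).

    For the five-point Laplacian the diagonal of A is a + tau b with
    b = 2 / dx^2 + 2 / dy^2, and the off-diagonal row sums are at most tau b.
    Since tau b <= s := 4 tau / h^2, the ratio theta = s / (a + s) works for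
    every row, and 2 theta^2 < 1 becomes 2 s^2 < (a + s)^2
    ([shifted_lap_iteration_converges]). The step size restrictions say
    sqrt 2 s < a for phi and sqrt 3 s < a + s for c, and either inequality
    implies the required one ([step_condition_rate]). *)

Set Implicit Arguments.
Unset Strict Implicit.
Unset Printing Implicit Defensive.

Import Order.TTheory GRing.Theory Num.Theory.
Import numFieldNormedType.Exports.

Local Open Scope classical_set_scope.
Local Open Scope ring_scope.

(** * A sup-norm contraction for split diagonally dominant systems *)

Definition row_dominant (R : realFieldType) (n : nat) (theta : R)
    (A : 'M[R]_n) : Prop :=
  forall i, A i i != 0 /\
    \sum_(j | j != i) `|A i j| <= theta * `|A i i|.

(** The block of [A] through which the unknowns outside [S] enter the equations
    of [S]; this is the part of [A] that the iteration treats explicitly. *)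
Definition coupling (R : realFieldType) (n : nat) (S : pred 'I_n)
    (A : 'M[R]_n) : 'M[R]_n :=
  \matrix_(i, j) (if S i && ~~ S j then A i j else 0).

(** One row of Jacobi's argument: solving a homogeneous equation for its
    diagonal unknown costs a factor [theta]. The entries of [y] need not be the
    components of one iterate, so that new and old values can be mixed. *)
Lemma row_dominant_le (R : realFieldType) (n : nat) (theta : R)
    (A : 'M[R]_n) (i : 'I_n) (y : 'I_n -> R) (m : R) :
  row_dominant theta A -> \sum_j A i j * y j = 0 -> 0 <= m ->
  (forall j, `|y j| <= m) -> `|y i| <= theta * m.
Proof.
move=> /(_ i)[Aii_neq0 domA] row0 m_ge0 y_le.
have Aii_gt0 : 0 < `|A i i| by rewrite normr_gt0.
have eqAy : A i i * y i = - \sum_(j | j != i) A i j * y j.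
  by apply/eqP; rewrite -addr_eq0 -[X in _ == X]row0 [eqbRHS](bigD1 i).
rewrite -(ler_pM2l Aii_gt0) -normrM eqAy normrN.
apply: le_trans (ler_norm_sum _ _ _) _.
rewrite mulrCA mulrA.
apply: le_trans (ler_wpM2r m_ge0 domA).
rewrite mulr_suml; apply: ler_sum => j _.
by rewrite normrM ler_wpM2l.
Qed.

(** The only input is the size of [v] off [S], because [coupling S A] does not
    see the components of [v] in [S]. The bound off [S] drives the induction,
    and the bound in [S] follows from it one step later. *)
Lemma coupling_step (R : realFieldType) (n : nat) (theta : R) (A : 'M[R]_n)
    (S : pred 'I_n) (u v : 'cV[R]_n) (c : R) :
  0 <= theta -> theta < 1 -> row_dominant theta A ->
  A *m u = coupling S A *m v -> 0 <= c ->
  (forall j, ~~ S j -> `|v j 0| <= c) ->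
  (forall j, ~~ S j -> `|u j 0| <= theta ^+ 2 / (1 - theta ^+ 2) * c) /\
  (forall j, S j -> `|u j 0| <= theta / (1 - theta ^+ 2) * c).
Proof.
move=> th_ge0 th_lt1 domA eqAu c_ge0 v_le.
pose p := \big[Num.max/0]_(j | S j) `|u j 0|.
pose q := \big[Num.max/0]_(j | ~~ S j) `|u j 0|.
have p_ge0 : 0 <= p by apply: bigmax_ge_id.
have q_ge0 : 0 <= q by apply: bigmax_ge_id.
have u_le_p j : S j -> `|u j 0| <= p.
  by move=> Sj; apply: (le_bigmax_cond 0 (fun j => `|u j 0|)).
have u_le_q j : ~~ S j -> `|u j 0| <= q.
  by move=> Sj; apply: (le_bigmax_cond 0 (fun j => `|u j 0|)).
have th2_lt1 : theta ^+ 2 < 1 by rewrite expr_lt1.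
have max_ge0 : 0 <= Num.max p (q + c) by rewrite le_max p_ge0.
have q_le : q <= theta * Num.max p q.
  apply/bigmax_leP; split; first by rewrite mulr_ge0 // le_max p_ge0.
  move=> i nSi; apply: (row_dominant_le (y := fun j => u j 0) domA).
  - move/matrixP/(_ i 0): eqAu; rewrite !mxE => ->.
    by apply: big1 => j _; rewrite mxE (negbTE nSi) mul0r.
  - by rewrite le_max p_ge0.
  - move=> j; rewrite le_max.
    by have [/u_le_p -> //|/u_le_q ->] := boolP (S j); rewrite orbT.
have p_le : p <= theta * Num.max p (q + c).
  apply/bigmax_leP; split; first by rewrite mulr_ge0.
  move=> i Si.
  (* The equation of row i is homogeneous in the new values on S and in the
     differences between new and old values off S. *)
  have -> : u i 0 = u i 0 - (if S i then 0 else v i 0) by rewrite Si subr0.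
  apply: (row_dominant_le (y := fun j => u j 0 - (if S j then 0 else v j 0))
    domA) => // [|j].
  - move/matrixP/(_ i 0): eqAu; rewrite !mxE => /eqP.
    rewrite -subr_eq0 -sumrB => /eqP sum0; rewrite -[RHS]sum0.
    apply: eq_bigr => j _.
    by rewrite mxE Si mulrBr; case: (S j); rewrite /= ?mulr0 ?mul0r.
  - have [Sj|nSj] := boolP (S j); rewrite le_max ?subr0 ?u_le_p //.
    by rewrite (le_trans (ler_normB _ _) (lerD (u_le_q _ nSj) (v_le _ nSj)))
               orbT.
(* Since theta < 1, a maximum attained strictly by the left-hand side would
   contradict either bound. *)
have q_le_p : q <= theta * p.
  by move: q_le; case: (leP p q) => // pq; nra.
have p_le_qc : p <= theta * (q + c).
  by move: p_le; case: (leP p (q + c)) => // qcp; nra.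
have den_gt0 : 0 < 1 - theta ^+ 2 by rewrite subr_gt0.
split=> j Sj.
- apply: le_trans (u_le_q _ Sj) _.
  by rewrite mulrAC ler_pdivlMr //; nra.
- apply: le_trans (u_le_p _ Sj) _.
  by rewrite mulrAC ler_pdivlMr //; nra.
Qed.

Lemma unitmx_col_inj (F : fieldType) (n : nat) (A : 'M[F]_n) :
  (forall u : 'cV[F]_n, A *m u = 0 -> u = 0) -> A \in unitmx.
Proof.
move=> injA; rewrite -unitmx_tr unitmxE unitfE; apply/det0P => -[v v_neq0 vA].
case/eqP: v_neq0; apply: trmx_inj; rewrite trmx0; apply: injA.
by rewrite -[A]trmxK -trmx_mul vA trmx0.
Qed.

(** Applied to [v = 0] the contraction estimate shows that [A] is injective, and
    applied to [v = u] that [A - coupling S A] is; so the iterates are defined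
    and there is a fixed point, and the errors of the iterates satisfy the
    homogeneous recursion. *)
Lemma coupling_iteration_converges (R : realType) (n : nat) (theta : R)
    (A : 'M[R]_n) (S : pred 'I_n) (g : 'cV[R]_n) :
  0 <= theta -> 2 * theta ^+ 2 < 1 -> row_dominant theta A ->
  iteration_converges A (coupling S A) g.
Proof.
move=> th_ge0 th2 domA.
have th_lt1 : theta < 1 by nra.
have den_gt0 : 0 < 1 - theta ^+ 2 by lra.
have th2_ge0 := sqr_ge0 theta.
set kappa := theta ^+ 2 / (1 - theta ^+ 2).
have kappa_ge0 : 0 <= kappa by apply: divr_ge0; lra.
have kappa_lt1 : kappa < 1 by rewrite ltr_pdivrMr; lra.
have unitA : A \in unitmx.
  apply: unitmx_col_inj => u Au0.
  have [|||uQ uP] := @coupling_step _ _ _ A S u 0 0 th_ge0 th_lt1 domA.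
  - by rewrite mulmx0.
  - by [].
  - by move=> j _; rewrite mxE normr0.
  apply/colP => j; rewrite mxE; apply/eqP; rewrite -normr_le0.
  by have [/uP|/uQ] := boolP (S j); rewrite mulr0.
have unitAB : A - coupling S A \in unitmx.
  apply: unitmx_col_inj => u /eqP; rewrite mulmxBl subr_eq0 => /eqP Au.
  pose q := \big[Num.max/0]_(j | ~~ S j) `|u j 0|.
  have q_ge0 : 0 <= q by apply: bigmax_ge_id.
  have [|uQ uP] := coupling_step th_ge0 th_lt1 domA Au q_ge0.
  - by move=> j Sj; apply: (le_bigmax_cond 0 (fun j => `|u j 0|)).
  have q_le : q <= kappa * q.
    by apply/bigmax_leP; split=> //; apply: mulr_ge0.
  have q0 : q = 0 by apply/eqP; rewrite eq_le q_ge0 andbT; nra.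
  apply/colP => j; rewrite mxE; apply/eqP; rewrite -normr_le0.
  by have [/uP|/uQ] := boolP (S j); rewrite q0 mulr0.
move=> x0; split.
  exists (fun k => iter k
    (fun x => invmx A *m (coupling S A *m x + g)) x0).
  by split=> // k; rewrite iterS mulKVmx.
move=> x [_ xS].
pose l := invmx (A - coupling S A) *m g.
have Al : A *m l = coupling S A *m l + g.
  by apply/eqP; rewrite addrC -subr_eq -mulmxBl mulKVmx.
exists l.
pose e k := x k - l.
have eS k : A *m e k.+1 = coupling S A *m e k.
  by rewrite !mulmxBr xS Al opprD addrACA subrr addr0.
pose C := \big[Num.max/0]_j `|e 0%N j 0|.
have C_ge0 : 0 <= C by apply: bigmax_ge_id.
have e_Q k : forall j, ~~ S j -> `|e k j 0| <= kappa ^+ k * C.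
  elim: k => [|k IHk] j Sj.
    by rewrite mul1r; apply: (le_bigmax 0 (fun j => `|e 0%N j 0|)).
  have kC_ge0 : 0 <= kappa ^+ k * C by rewrite mulr_ge0 ?exprn_ge0.
  rewrite exprS -mulrA.
  by have [uQ _] := coupling_step th_ge0 th_lt1 domA (eS k) kC_ge0 IHk; apply: uQ.
(* The error at step k.+1 is bounded through the error off S at step k, on S by
   the first summand of D and off S by the second one. *)
pose D := theta / (1 - theta ^+ 2) * C + C.
have e_le k j : `|e k.+1 j 0| <= kappa ^+ k * D.
  have kC_ge0 : 0 <= kappa ^+ k * C by rewrite mulr_ge0 ?exprn_ge0.
  have kC'_ge0 : 0 <= kappa ^+ k * (theta / (1 - theta ^+ 2) * C).
    by rewrite !mulr_ge0 ?exprn_ge0 ?invr_ge0 ?(ltW den_gt0).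
  rewrite mulrDr.
  have [_ uP] := coupling_step th_ge0 th_lt1 domA (eS k) kC_ge0 (e_Q k).
  have [Sj|nSj] := boolP (S j).
    by apply: le_trans (uP _ Sj) _; rewrite mulrCA lerDl.
  apply: le_trans (e_Q k.+1 _ nSj) _; rewrite exprS -mulrA.
  by apply: ler_wpDl => //; apply: ler_piMl; rewrite // ltW.
rewrite -cvg_shiftS; apply/subr_cvg0/norm_cvg0P.
have kD : (kappa ^+ k * D) @[k --> \oo] --> (0 : R).
  rewrite -(mul0r D); apply: cvgMl.
  by apply: cvg_expr; rewrite ger0_norm.
apply: (squeeze_cvgr _ (cvg_cst 0) kD).
near=> k; rewrite normr_ge0 /= [X in X <= _]mx_normrE.
apply/bigmax_leP; split=> [|[i j] _ /=].
  by rewrite mulr_ge0 ?exprn_ge0 // addr_ge0 // mulr_ge0 // divr_ge0 // ltW.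
by rewrite ord1; apply: e_le.
Unshelve. all: by end_near.
Qed.

(** * Row sums of the discrete Laplacian *)

Lemma lap1_diag (R : realType) (m : nat) (d : R) (i : 'I_m) :
  lap1 m d i i = - (2 / d ^+ 2).
Proof. by rewrite !mxE eqxx mulrC mulNr. Qed.

Lemma sumr_pred_le1 (R : numDomainType) (I : finType) (P : pred I) :
  (forall j k, P j -> P k -> j = k) -> \sum_j (P j)%:R <= 1 :> R.
Proof.
move=> P_inj; rewrite -natr_sum lern1.
suff -> : (\sum_j P j)%N = #|P| by apply/card_le1_eqP => j k Pj Pk; apply: P_inj.
by rewrite -sum1_card [RHS]big_mkcond.
Qed.

(** The bound is attained in interior rows. The indicators in the proof count
    the node itself, its right and its left neighbour, the latter two being
    absent at the ends of the interval. *)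
Lemma lap1_row_sum (R : realType) (m : nat) (d : R) (i : 'I_m) :
  \sum_j `|lap1 m d i j| <= 4 / d ^+ 2.
Proof.
have dV_ge0 : 0 <= (d ^+ 2)^-1 by rewrite invr_ge0 sqr_ge0.
have term_le (j : 'I_m) : `|lap1 m d i j| <=
    (d ^+ 2)^-1 * (2 * (i == j)%:R + (i.+1 == j :> nat)%:R
                   + (j.+1 == i :> nat)%:R).
  rewrite !mxE normrM ger0_norm // ler_wpM2l //.
  case: (i == j).
    by rewrite normrN ger0_norm //; case: (_ == _); case: (_ == _) => /=; lra.
  by case: (_ == _); case: (_ == _) => /=; rewrite ?normr0 ?normr1; lra.
apply: le_trans (ler_sum _ (fun j _ => term_le j)) _.
rewrite -mulr_sumr mulrC ler_wpM2r //.
rewrite !big_split -mulr_sumr /=.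
have self : \sum_(j < m) (i == j)%:R <= 1 :> R.
  by apply: sumr_pred_le1 => j k /eqP <- /eqP.
have next : \sum_(j < m) (i.+1 == j :> nat)%:R <= 1 :> R.
  by apply: sumr_pred_le1 => j k /eqP ij /eqP ik; apply: val_inj; rewrite /= -ij.
have prev : \sum_(j < m) (j.+1 == i :> nat)%:R <= 1 :> R.
  by apply: sumr_pred_le1 => j k /eqP ij /eqP; rewrite -ij => -[] /val_inj.
lra.
Qed.

Lemma tensmx_row_sum (R : numDomainType) (m n p q : nat)
    (A : 'M[R]_(m, n)) (B : 'M[R]_(p, q)) (i : 'I_(m * p)) :
  \sum_j `|(A *t B) i j| =
  (\sum_k `|A (mxtens_unindex i).1 k|) * (\sum_l `|B (mxtens_unindex i).2 l|).
Proof. by rewrite mulr_sum; apply: eq_bigr => j _; rewrite mxE normrM. Qed.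

Lemma scalar1_row_sum (R : numDomainType) (n : nat) (i : 'I_n) :
  \sum_j `|(1%:M : 'M[R]_n) i j| = 1.
Proof.
rewrite (bigD1 i) //= big1 => [|j neq_ji]; first by rewrite mxE eqxx addr0 normr1.
by rewrite mxE eq_sym (negbTE neq_ji) normr0.
Qed.

Lemma lap_diag (R : realType) (Lx Ly : R) (mx my : nat)
    (p : 'I_(my * mx)) :
  lap Lx Ly mx my p p = - (2 / mesh Lx mx ^+ 2 + 2 / mesh Ly my ^+ 2).
Proof.
case: (mxtens_indexP p) => j i.
by rewrite /lap mxE !tensmxE !lap1_diag !mxE !eqxx mul1r mulr1 opprD.
Qed.

(** The full absolute row sum is at most twice the modulus of the diagonal
    entry, by the one-dimensional bound and the multiplicativity of row sums
    under Kronecker products; removing the diagonal entry leaves the bound. *)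
Lemma lap_offdiag_row_sum (R : realType) (Lx Ly : R) (mx my : nat)
    (p : 'I_(my * mx)) :
  \sum_(q | q != p) `|lap Lx Ly mx my p q| <=
  2 / mesh Lx mx ^+ 2 + 2 / mesh Ly my ^+ 2.
Proof.
set b := _ + _.
have b_ge0 : 0 <= b by rewrite addr_ge0 // divr_ge0 // sqr_ge0.
have full : \sum_q `|lap Lx Ly mx my p q| <= b + b.
  apply: (@le_trans _ _ (4 / mesh Lx mx ^+ 2 + 4 / mesh Ly my ^+ 2)); last first.
    by rewrite /b; lra.
  rewrite /lap; set Tx := tensmx _ _; set Ty := tensmx _ _.
  apply: (@le_trans _ _ (\sum_q (`|Tx p q| + `|Ty p q|))).
    by apply: ler_sum => q _; rewrite mxE ler_normD.
  rewrite big_split /= !tensmx_row_sum !scalar1_row_sum mul1r mulr1.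
  by rewrite lerD // lap1_row_sum.
by move: full; rewrite (bigD1 p) //= lap_diag -/b normrN ger0_norm // lerD2l.
Qed.

(** * Convergence of the iterations *)

Lemma mesh_gt0 (R : realType) (L : R) (m : nat) : 0 < L -> 0 < mesh L m.
Proof. by move=> L_gt0; rewrite divr_gt0. Qed.

(** Identifies the nodes of the perforated domain with those outside the
    holes. *)
Lemma node_in_Omega (R : realType) (Lx Ly : R) (mx my : nat)
    (p : 'I_(my * mx)) :
  0 < Lx -> 0 < Ly -> Omega Lx Ly (node Lx Ly p).
Proof.
have inside (L : R) (m : nat) (i : 'I_m) :
    0 < L -> i.+1%:R * mesh L m \in `[0, L].
  move=> L_gt0; rewrite in_itv /= mulr_ge0 ?(ltW (mesh_gt0 _ _)) //=.
  by rewrite /mesh mulrCA ger_pMr // ler_pdivrMr // mul1r ler_nat ltnS ltnW.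
move=> Lx_gt0 Ly_gt0; rewrite /node; case: (mxtens_unindex p) => j i.
by split; rewrite /= inside.
Qed.

(** The dominance ratio of a row is tau b / (a + tau b) with
    b = 2 / dx^2 + 2 / dy^2; it increases with b, and b <= 4 / h^2. *)
Lemma shifted_lap_iteration_converges (R : realType) (Lx Ly : R) (mx my : nat)
    (Theta : set (R * R)) (a tau h : R) (g : 'cV[R]_(my * mx)) :
  0 < Lx -> 0 < Ly -> 0 < a -> 0 < tau ->
  0 < h -> h <= mesh Lx mx -> h <= mesh Ly my ->
  2 * (4 * tau / h ^+ 2) ^+ 2 < (a + 4 * tau / h ^+ 2) ^+ 2 ->
  iteration_converges (a%:M - tau *: lap Lx Ly mx my)
    (- tau *: lapN1 Lx Ly mx my Theta) g.
Proof.
move=> Lx_gt0 Ly_gt0 a_gt0 tau_gt0 h_gt0 h_lex h_ley.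
set s := 4 * tau / h ^+ 2 => s_lt.
set A := a%:M - _.
pose S (p : 'I_(my * mx)) := node Lx Ly p \in Theta.
have offdiagA p q : q != p -> A p q = - tau * lap Lx Ly mx my p q.
  by move=> neq_qp; rewrite !mxE eq_sym (negbTE neq_qp) sub0r mulNr.
have -> : - tau *: lapN1 Lx Ly mx my Theta = coupling S A.
  apply/matrixP => p q; rewrite [LHS]mxE [X in _ * X]mxE [RHS]mxE.
  have -> : (node Lx Ly q \in Omega_hat Lx Ly Theta) = ~~ S q.
    apply/idP/idP; rewrite /S notin_setE inE; first by case.
    by split=> //; apply: node_in_Omega.
  rewrite -/(S p); case: ifP => [/andP[Sp nSq]|_]; last by rewrite mulr0.
  by rewrite offdiagA //; apply: contraNneq nSq => ->.
have s_gt0 : 0 < s by rewrite divr_gt0 ?exprn_gt0 // mulr_gt0.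
have as_gt0 : 0 < a + s by rewrite addr_gt0.
apply: (@coupling_iteration_converges _ _ (s / (a + s))).
- by apply: divr_ge0; apply: ltW.
- by rewrite expr_div_n mulrA ltr_pdivrMr ?exprn_gt0 // mul1r.
move=> p; pose b := 2 / mesh Lx mx ^+ 2 + 2 / mesh Ly my ^+ 2.
have inv_le (d : R) : h <= d -> 2 / d ^+ 2 <= 2 / h ^+ 2.
  move=> h_le; rewrite ler_pM2l // lef_pV2 ?posrE ?exprn_gt0 //.
    by rewrite lerXn2r // nnegrE ltW // (lt_le_trans h_gt0).
  exact: lt_le_trans h_le.
have tb_le : tau * b <= s.
  have -> : s = tau * (2 / h ^+ 2 + 2 / h ^+ 2) by rewrite /s; ring.
  by rewrite ler_pM2l // lerD // inv_le.
have tb_ge0 : 0 <= tau * b.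
  by rewrite mulr_ge0 ?(ltW tau_gt0) // addr_ge0 // divr_ge0 // sqr_ge0.
have App : A p p = a + tau * b.
  rewrite /A [LHS]mxE [X in X + _]mxE eqxx mulr1n mxE mxE lap_diag -/b.
  by rewrite mulrN opprK.
have App_gt0 : 0 < A p p by rewrite App ltr_wpDr.
split; first by rewrite gt_eqF.
rewrite (ger0_norm (ltW App_gt0)) App.
apply: (@le_trans _ _ (tau * b)).
  under eq_bigr => q neq_qp.
    rewrite offdiagA // normrM normrN (gtr0_norm tau_gt0); over.
  by rewrite -mulr_sumr ler_pM2l // lap_offdiag_row_sum.
by rewrite mulrAC ler_pdivlMr //; nra.
Qed.

(** The factor [c] is the normalisation of the scheme: Euler has [gamma = 1] and
    [c = 1], 2SBDF has [gamma = 3 / 2] and [c = 2]. Clearing denominators, the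
    conditions read sqrt 2 s < a for phi, and 2 s < (1 + sqrt 3) a for c, which
    is (sqrt 3 - 1) s < a; in both cases k s < a + s for a k with k^2 >= 2. *)
Lemma step_condition_rate (R : realType) (gamma h Dphi Dc w dt c : R) :
  0 < gamma -> 0 < h -> 0 < Dphi -> 0 < Dc -> 0 < w -> 0 < dt -> 0 < c ->
  step_condition gamma h Dphi Dc w dt ->
  let rate a tau := 2 * (4 * tau / h ^+ 2) ^+ 2 < (a + 4 * tau / h ^+ 2) ^+ 2 in
  rate (c * (gamma + w * dt)) (c * dt * Dphi) /\
  rate (c * gamma) (c * dt * Dc).
Proof.
move=> g_gt0 h_gt0 Dphi_gt0 Dc_gt0 w_gt0 dt_gt0 c_gt0 [phi_cond c_cond] rate.
have h2_gt0 : 0 < h ^+ 2 by rewrite exprn_gt0.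
have cut (a tau k : R) : 0 < a -> 0 < tau -> 0 <= k -> 2 <= k ^+ 2 ->
    (k * tau * 4 < (a * h ^+ 2 + 4 * tau)) -> rate a tau.
  move=> a_gt0 tau_gt0 k_ge0 k2 lt_k; rewrite /rate.
  have -> : a + 4 * tau / h ^+ 2 = (a * h ^+ 2 + 4 * tau) / h ^+ 2.
    by field; lra.
  rewrite !expr_div_n mulrA ltr_pM2r ?invr_gt0 ?exprn_gt0 //.
  have sq : (k * tau * 4) ^+ 2 < (a * h ^+ 2 + 4 * tau) ^+ 2.
    by rewrite ltr_pXn2r // nnegrE; nra.
  apply: le_lt_trans sq; have := sqr_ge0 tau; nra.
have sqrt2 : Num.sqrt 2 ^+ 2 = 2 :> R by rewrite sqr_sqrtr.
have sqrt3 : Num.sqrt 3 ^+ 2 = 3 :> R by rewrite sqr_sqrtr.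
have sqrt2_gt0 : 0 < Num.sqrt 2 :> R by rewrite sqrtr_gt0.
have sqrt3_gt0 : 0 < Num.sqrt 3 :> R by rewrite sqrtr_gt0.
split.
- apply: (cut _ _ (Num.sqrt 2)); rewrite ?sqrt2 ?(ltW sqrt2_gt0) ?mulr_gt0 ?addr_gt0 ?mulr_gt0 //.
  have phi_lt : 4 * Num.sqrt 2 * Dphi * dt < (gamma + w * dt) * h ^+ 2.
    (* A negative denominator is the case where the zeroth-order term alone
       suffices; for a zero denominator neither alternative can hold. *)
    have [E_neg|E_ge0] := ltP (4 * Num.sqrt 2 * Dphi - w * h ^+ 2) 0.
      nra.
    case: phi_cond => [|].
      by rewrite ltr_pdivrMr // => ?; lra.
    move: E_ge0; rewrite le_eqVlt => /orP[/eqP <-|E_gt0].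
      by rewrite invr0 mulr0; lra.
    by rewrite ltr_pdivlMr //; lra.
  have : c * (4 * Num.sqrt 2 * Dphi * dt) < c * ((gamma + w * dt) * h ^+ 2).
    by rewrite ltr_pM2l.
  have : 0 < c * dt * Dphi by rewrite !mulr_gt0.
  lra.
- apply: (cut _ _ (Num.sqrt 3)); rewrite ?sqrt3 ?(ltW sqrt3_gt0) ?mulr_gt0 ?ler_nat //.
  have c_lt : 8 * Dc * dt < gamma * (1 + Num.sqrt 3) * h ^+ 2.
    by move: c_cond; rewrite mulrAC ltr_pdivlMr ?mulr_gt0 //; lra.
  (* Multiplying by sqrt 3 - 1 turns 1 + sqrt 3 into 2. *)
  have sqrt3_gt1 : 1 < Num.sqrt 3 :> R by nra.
  have c_lt' : 4 * (Num.sqrt 3 - 1) * (Dc * dt) < gamma * h ^+ 2.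
    have : (Num.sqrt 3 - 1) * (8 * Dc * dt) <
        (Num.sqrt 3 - 1) * (gamma * (1 + Num.sqrt 3) * h ^+ 2).
      by rewrite ltr_pM2l // subr_gt0.
    have -> : (Num.sqrt 3 - 1) * (gamma * (1 + Num.sqrt 3) * h ^+ 2) =
       (Num.sqrt 3 ^+ 2 - 1) * (gamma * h ^+ 2) :> R by ring.
    rewrite sqrt3; lra.
  have : c * (4 * (Num.sqrt 3 - 1) * (Dc * dt)) < c * (gamma * h ^+ 2).
    by rewrite ltr_pM2l.
  lra.
Qed.

Theorem theorem5 (R : realType) (Lx Ly : R) (mx my : nat)
    (Theta : set (R * R)) (Dphi Dc w dt : R)
    (Lx_gt0 : 0 < Lx) (Ly_gt0 : 0 < Ly)
    (mx_gt0 : (0 < mx)%N) (my_gt0 : (0 < my)%N)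
    (Theta_int : Theta `<=` interior (Omega Lx Ly))
    (Theta_node : exists p : 'I_(my * mx), Theta (node Lx Ly p))
    (Dphi_gt0 : 0 < Dphi) (Dc_gt0 : 0 < Dc) (w_gt0 : 0 < w) (dt_gt0 : 0 < dt) :
  let h := Num.min (mesh Lx mx) (mesh Ly my) in
  let M := lap Lx Ly mx my in
  let N := lapN1 Lx Ly mx my Theta in
  (step_condition 1 h Dphi Dc w dt -> euler_converges M N Dphi Dc w dt) /\
  (step_condition (3 / 2) h Dphi Dc w dt -> sbdf2_converges M N Dphi Dc w dt).
Proof.
move=> h M N.
have h_gt0 : 0 < h by rewrite lt_min !mesh_gt0.
have h_lex : h <= mesh Lx mx by rewrite ge_min lexx.
have h_ley : h <= mesh Ly my by rewrite ge_min lexx orbT.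
have wdt_gt0 : 0 < w * dt by rewrite mulr_gt0.
split=> cond gphi gc.
- have [||rate_phi rate_c] := @step_condition_rate _ _ _ _ _ _ _ 1 _
    h_gt0 Dphi_gt0 Dc_gt0 w_gt0 dt_gt0 _ cond => //.
  rewrite !mul1r in rate_phi rate_c.
  by split; apply: (@shifted_lap_iteration_converges _ _ _ _ _ _ _ _ h) => //;
     rewrite ?mulr_gt0 // addr_gt0.
- have [||rate_phi rate_c] := @step_condition_rate _ _ _ _ _ _ _ 2 _
    h_gt0 Dphi_gt0 Dc_gt0 w_gt0 dt_gt0 _ cond => //.
  have eq3 : 2 * (3 / 2) = 3 :> R by field.
  rewrite mulrDr eq3 mulrA in rate_phi; rewrite eq3 in rate_c.
  by split; apply: (@shifted_lap_iteration_converges _ _ _ _ _ _ _ _ h) => //;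
     rewrite ?mulr_gt0 // addr_gt0 // mulr_gt0 // mulr_gt0.
Qed.
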